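(* Let $q$ be a prime power and $n,m$ integers with $m\geq 3$ and $n\geq 4$. Let $\mathbf{A}=(\alpha_1,\dots,\alpha_m)\in(\mathbb{F}_{q^n}^* )^m$ be such that $K_{\mathbf{A}}:=\alpha_1^{q^{m-1}}\alpha_2\alpha_3^{q}\cdots\alpha_m^{q^{m-2}}$ is not a $(1+q+\cdots+q^{m-1})$-th power in $\mathbb{F}_{q^n}$. Then the $\mathbb{F}_q$-subspace $$V_{\mathbf{A},2}:=\{(\underline{x},\underline{x}^q,f_1(\underline{x}),\dots,f_m(\underline{x})):\underline{x}\in\mathbb{F}_{q^n}^m\}\subseteq\mathbb{F}_{q^n}^{3m},$$ where $f_i(\underline{x})=x_i^{q^2}+\alpha_{i+1}x_{i+1}^{q^{3}}$ for $i=1,\dots,m-1$ and $f_m(\underline{x})=x_m^{q^2}+\alpha_1x_1^{q^{3}}$, is $(3,4)$-evasive.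
   Context: For $\underline{x}=(x_1,\dots,x_m)$, $\underline{x}^{q}=(x_1^{q},\dots,x_m^{q})$. Let $h<k$ and $h\leq r$ be positive integers. An $\mathbb{F}_q$-subspace $U\subseteq\mathbb{F}_{q^n}^k$ is $(h,r)$-evasive if for every $h$-dimensional $\mathbb{F}_{q^n}$-subspace $H\subseteq\mathbb{F}_{q^n}^k$ one has $\dim_{\mathbb{F}_q}(U\cap H)\leq r$. *)

(* Defs.v *)
From HB Require Import structures.
From mathcomp Require Import all_boot all_order all_algebra all_field.

Set Implicit Arguments.
Unset Strict Implicit.
Unset Printing Implicit Defensive.

Import GRing.Theory.
Local Open Scope ring_scope.

(* Throughout, F plays the role of F_q with q = #|F|, and L that of F_{q^n}
   with n = \dim {:L}. The space L^k carries two linear structures on the same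
   underlying type: {ffun 'I_k -> L} is an F-vector space and
   {ffun 'I_k -> L^o} is an L-vector space, L^o being L regarded as a
   one-dimensional vector space over itself. *)

Section Evasive.

Variables (F : fieldType) (L : fieldExtType F) (k : nat).
Implicit Types (U : {vspace {ffun 'I_k -> L}}).
Implicit Types (H : {vspace {ffun 'I_k -> L^o}}).

Definition compl_part H (v : {ffun 'I_k -> L}) : {ffun 'I_k -> L} :=
  v - (projv H v : {ffun 'I_k -> L}).

Lemma compl_part_is_linear H : linear (compl_part H).
Proof.
move=> a u v; rewrite /compl_part.
have -> : projv H (a *: u + v) = (a *: (projv H u : {ffun 'I_k -> L}) + projv H v
   :> {ffun 'I_k -> L}).
  have E (w : {ffun 'I_k -> L}) :
      a *: w = ((a%:A : L) *: (w : {ffun 'I_k -> L^o}) : {ffun 'I_k -> L^o}).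
    by apply/ffunP=> i; rewrite !ffunE /= /GRing.scale /= mulr_algl.
  by rewrite !E linearP.
by rewrite scalerBr opprD addrACA.
Qed.

HB.instance Definition _ H :=
  GRing.isLinear.Build F {ffun 'I_k -> L} {ffun 'I_k -> L} _ (compl_part H)
    (compl_part_is_linear H).

(* Restriction of scalars: the L-subspace H seen as an F-subspace. *)
Definition restrict_scalars H : {vspace {ffun 'I_k -> L}} :=
  lker (linfun (compl_part H)).

Lemma memv_restrict_scalars H (v : {ffun 'I_k -> L}) :
  (v \in restrict_scalars H) = ((v : {ffun 'I_k -> L^o}) \in H).
Proof.
rewrite memv_ker lfunE /= /compl_part subr_eq0.
apply/eqP/idP => [->|vH]; first exact: memv_proj.
by rewrite projv_id.
Qed.

Definition evasive (h r : nat) U : Prop :=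
  forall H : {vspace {ffun 'I_k -> L^o}},
    \dim H = h -> (\dim (U :&: restrict_scalars H) <= r)%N.

End Evasive.

Section TheSubspace.

Variables (F : finFieldType) (L : fieldExtType F) (m : nat).
Variable A : {ffun 'I_m -> L}.

Local Notation q := #|F|.

(* Indices start at 0, and ordS is the cyclic successor on 'I_m, so that the
   last component of VA2_map involves the first entry of A and of x. *)
Definition fA2 (i : 'I_m) (x : {ffun 'I_m -> L}) : L :=
  x i ^+ (q ^ 2) + A (ordS i) * x (ordS i) ^+ (q ^ 3).

Definition VA2_map (x : {ffun 'I_m -> L}) : {ffun 'I_(m + m + m) -> L} :=
  [ffun j => match split j with
             | inl j' => match split j' with
                         | inl i => x i
                         | inr i => x i ^+ q
                         end
             | inr i => fA2 i x
             end].

Lemma expr_card_linear (s : nat) (a : F) (u v : L) :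
  (a *: u + v) ^+ (q ^ s) = a *: u ^+ (q ^ s) + v ^+ (q ^ s).
Proof.
have [p p_pr pF] := finPcharP F.
have pL : p \in [pchar L] by rewrite (fmorph_pchar (in_alg L)).
have q_p : [pchar L].-nat (q ^ s)%N.
  rewrite (eq_pnat _ (pcharf_eq pL)) (card_pprimeChar pF).
  by rewrite !pnatX pnat_id.
rewrite exprDn_pchar // exprZn; congr (_ *: _ + _).
by elim: s {q_p} => [|s IHs]; rewrite ?expn0 // expnSr exprM IHs expf_card.
Qed.

Lemma VA2_map_is_linear : linear VA2_map.
Proof.
move=> a x y; apply/ffunP=> j; rewrite !ffunE.
have E1 := expr_card_linear 1; rewrite expn1 in E1.
case: split => [j'|i]; first by case: split => i; rewrite !ffunE ?E1.
rewrite /fA2 !ffunE !expr_card_linear scalerDr mulrDr scalerAr.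
by rewrite addrACA.
Qed.

HB.instance Definition _ :=
  GRing.isLinear.Build F {ffun 'I_m -> L} {ffun 'I_(m + m + m) -> L} _ VA2_map
    VA2_map_is_linear.

Definition VA2 : {vspace {ffun 'I_(m + m + m) -> L}} := limg (linfun VA2_map).

Lemma memv_VA2 (v : {ffun 'I_(m + m + m) -> L}) :
  v \in VA2 <-> exists x : {ffun 'I_m -> L}, v = VA2_map x.
Proof.
split=> [/memv_imgP[x _ ->]|[x ->]]; first by exists x; rewrite lfunE.
by rewrite -[VA2_map x]lfunE; apply: memv_img; apply: memvf.
Qed.

(* ord_pred is the cyclic predecessor on 'I_m: the exponents are q ^ (m - 1)
   for the first entry of A and then q ^ 0, q ^ 1, ..., q ^ (m - 2). *)
Definition KA : L := \prod_(i < m) A i ^+ (q ^ ord_pred i).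

End TheSubspace.

(* Main.v *)
(* Suppose an L-subspace H of dimension 3 meets V_{A,2} in an F-space of
   dimension N >= 5, and let the columns of the m x N matrix X be the vectors x
   of an F-basis. The rows of X, of X^s (s the Frobenius map) and of the
   f_i-part all lie in a subspace Z of L^N of dimension at most 3, while no
   nonzero vector of F^N is orthogonal to X. A subspace of L^N with the latter
   property that is stable under s is the whole of L^N, so each application of
   Y |-> Y + Y^s raises the dimension until it reaches N. This forces X to have
   rank 1, X = u v, with v, v^s, v^(s^2), v^(s^3) independent. Then the vectors
   u_i^(s^2) v^(s^2) + alpha_(i+1) u_(i+1)^(s^3) v^(s^3) must be pairwise
   proportional, that is alpha_(i+1) mu_(i+1)^q = b mu_i with mu = u^(s^2);
   multiplying the q^i-th powers of these around the cycle shows that K_A is a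
   (1 + q + ... + q^(m-1))-th power. *)
From HB Require Import structures.
Require Import Defs.
From mathcomp Require Import all_boot all_order all_algebra all_field.

Set Implicit Arguments.
Unset Strict Implicit.
Unset Printing Implicit Defensive.

Import GRing.Theory.
Local Open Scope ring_scope.

(** * The Frobenius map of L over F *)

Definition frob (F : finFieldType) (L : fieldExtType F) (x : L) : L := x ^+ #|F|.

Section Frobenius.

Variables (F : finFieldType) (L : fieldExtType F).

Lemma frob_is_zmod_morphism : zmod_morphism (@frob F L).
Proof.
move=> x y; have := expr_card_linear 1 (-1) y x.
by rewrite expn1 !scaleN1r ![- _ + _]addrC.
Qed.

Lemma frob_is_monoid_morphism : monoid_morphism (@frob F L).
Proof. by split=> [|x y]; rewrite /frob ?expr1n ?exprMn. Qed.

HB.instance Definition _ :=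
  GRing.isZmodMorphism.Build L L (@frob F L) frob_is_zmod_morphism.
HB.instance Definition _ :=
  GRing.isMonoidMorphism.Build L L (@frob F L) frob_is_monoid_morphism.

Lemma iter_frob (k : nat) (x : L) : iter k (@frob F L) x = x ^+ (#|F| ^ k).
Proof. by elim: k => [|k IHk]; rewrite ?expn0 // iterS IHk /frob -exprM expnSr. Qed.

Lemma frob_fixed (x : L) : frob x = x -> exists a : F, x = a%:A.
Proof.
move=> fx; have /vlineP[a ->] : x \in 1%VS; last by exists a.
by rewrite (Fermat's_little_theorem (1%AS : {subfield L})) dimv1 expn1 -/(frob x) fx.
Qed.

End Frobenius.

(** * Row spaces of matrices over L and their Frobenius twists *)

Section FrobeniusMatrix.

Variables (F : finFieldType) (L : fieldExtType F).

Local Notation "M ^s" := (map_mx (@frob F L) M) (at level 2, format "M ^s").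

(** Equivalently, the columns of [Y] are linearly independent over F; only the row space of [Y] over
    L matters. *)
Definition rationally_nondegenerate (p N : nat) (Y : 'M[L]_(p, N)) : Prop :=
  forall c : 'cV[F]_N, Y *m map_mx (in_alg L) c = 0 -> c = 0.

Lemma rationally_nondegenerateS (p1 p2 N : nat) (Y1 : 'M[L]_(p1, N)) (Y2 : 'M[L]_(p2, N)) :
  (Y1 <= Y2)%MS -> rationally_nondegenerate Y1 -> rationally_nondegenerate Y2.
Proof.
by move=> /submxP[D ->] ndY c Yc; apply: ndY; rewrite -mulmxA Yc mulmx0.
Qed.

(* Among the vectors of the kernel of [Y] with some entry equal to 1, one of
   minimal support is rational, because c^s - c has smaller support. *)
Lemma frob_stable_row_full (p N : nat) (Y : 'M[L]_(p, N)) :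
  rationally_nondegenerate Y -> (Y^s <= Y)%MS -> row_full Y.
Proof.
move=> ndY sYY.
(* Twisting preserves the rank, so the inclusion is an equality of row spaces; hence the kernel of
   [Y] is stable under the Frobenius map. *)
have [D YD] : exists D, Y = D *m Y^s.
  apply/submxP; have [_ eqr] := mxrank_leqif_sup sYY.
  by rewrite -eqr mxrank_map.
have ker0 k (c : 'cV[L]_N) : (#|[pred i | (c i 0 != 0)%R]| <= k)%N -> Y *m c = 0 -> c = 0.
  elim: k c => [|k IHk] c.
    rewrite leqn0 => /eqP/card0_eq c0 _.
    apply/matrixP=> i j; rewrite ord1 mxE; apply/eqP.
    by have := c0 i; rewrite !inE => /negbFE.
  move=> lek Yc; apply/eqP/negPn/negP=> c_n0.
  have [i ci] : exists i, c i 0 != 0.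
    apply/existsP; apply: contraNT c_n0 => /existsPn c0.
    by apply/eqP/matrixP=> i j; rewrite ord1 mxE; have /negPn/eqP := c0 i.
  pose d := (c i 0)^-1 *: c.
  have Yd : Y *m d = 0 by rewrite -scalemxAr Yc scaler0.
  have di : d i 0 = 1 by rewrite mxE mulVf.
  have sd : d^s - d = 0.
    apply: IHk; last first.
      by rewrite mulmxBr Yd subr0 {1}YD -mulmxA -map_mxM Yd map_mx0 mulmx0.
    rewrite -ltnS; apply: leq_trans lek; apply: proper_card.
    apply/properP; split.
      apply/subsetP=> j; rewrite !inE; apply: contraNneq => cj.
      by rewrite !mxE cj mulr0 rmorph0 subrr.
    by exists i; rewrite !inE // mxE [(- d) _ _]mxE [(d^s) _ _]mxE di rmorph1 subrr eqxx.
  have rat j : exists a : F, d j 0 == a%:A.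
    have [|a ->] := @frob_fixed _ _ (d j 0); last by exists a.
    apply/eqP; rewrite -subr_eq0; move/matrixP: sd => /(_ j 0).
    by rewrite !mxE => ->.
  pose e : 'cV[F]_N := \col_j xchoose (rat j).
  have de : d = map_mx (in_alg L) e.
    apply/matrixP=> j l; rewrite ord1 [RHS]mxE [e j 0]mxE.
    exact: (eqP (xchooseP (rat j))).
  have e0 : e = 0 by apply: ndY; rewrite -de.
  by move: di; rewrite de e0 map_mx0 mxE => /esym/eqP; rewrite oner_eq0.
rewrite -cokermx_eq0; apply/eqP/matrixP=> i j; rewrite [RHS]mxE.
have -> : cokermx Y i j = col j (cokermx Y) i 0 by rewrite [RHS]mxE.
rewrite (ker0 _ (col j (cokermx Y)) (leqnn _)) ?[LHS]mxE //.
by rewrite colE mulmxA mulmx_coker mul0mx.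
Qed.

Definition frob_span (p N : nat) (Y : 'M[L]_(p, N)) : 'M[L]_N := (Y + Y^s)%MS.

Lemma frob_spanS (p1 p2 N : nat) (Y1 : 'M[L]_(p1, N)) (Y2 : 'M[L]_(p2, N)) :
  (Y1 <= Y2)%MS -> (frob_span Y1 <= frob_span Y2)%MS.
Proof. by move=> sY; rewrite addsmxS // map_submx. Qed.

Lemma frob_span_nondegenerate (p N : nat) (Y : 'M[L]_(p, N)) :
  rationally_nondegenerate Y -> rationally_nondegenerate (frob_span Y).
Proof. exact/rationally_nondegenerateS/addsmxSl. Qed.

(** If the rank does not grow, [Y^s] lies in the row space of [Y], which is then everything by
    [frob_stable_row_full]. *)
Lemma frob_span_rank (p N : nat) (Y : 'M[L]_(p, N)) :
  rationally_nondegenerate Y ->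
  (minn N (\rank Y).+1 <= \rank (frob_span Y))%N.
Proof.
move=> ndY; have sYS : (Y <= frob_span Y)%MS by exact: addsmxSl.
have [ler|ltr] := leqP (\rank (frob_span Y)) (\rank Y); last by rewrite geq_min ltr orbT.
rewrite geq_min; apply/orP; left; apply: leq_trans (mxrankS sYS).
rewrite col_leq_rank; apply: frob_stable_row_full => //.
apply: submx_trans (addsmxSr Y _) _; rewrite -/(frob_span Y).
have [le1 <-] := mxrank_leqif_sup sYS.
by rewrite eqn_leq le1.
Qed.

(* Submodularity: the two summands of the outer span share [Y^s]. *)
Lemma frob_span2_rank (p N : nat) (Y : 'M[L]_(p, N)) :
  (\rank (frob_span (frob_span Y)) + \rank Y <= (\rank (frob_span Y)).*2)%N.
Proof.
rewrite -addnn -{2}(mxrank_map (@frob F L) (frob_span Y)) -[leqRHS]mxrank_sum_cap leq_add2l.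
rewrite -(mxrank_map (@frob F L) Y); apply: mxrankS.
by rewrite sub_capmx addsmxSr map_submx addsmxSl.
Qed.

Lemma rank_frob_span3 (p N : nat) (Y : 'M[L]_(p, N)) :
  (0 < \rank Y)%N -> (4 <= N)%N -> rationally_nondegenerate Y ->
  (4 <= \rank (frob_span (frob_span (frob_span Y))))%N.
Proof.
move=> rY N4 ndY; have nd1 := frob_span_nondegenerate ndY.
have nd2 := frob_span_nondegenerate nd1.
apply: leq_trans (frob_span_rank nd2); rewrite leq_min N4 ltnS.
apply: leq_trans (frob_span_rank nd1); rewrite leq_min (ltnW N4) ltnS.
by apply: leq_trans (frob_span_rank ndY); rewrite leq_min (ltnW (ltnW N4)).
Qed.

Lemma frob_span_map_sub (p N : nat) (Y : 'M[L]_(p, N)) :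
  ((frob_span Y)^s <= frob_span Y^s)%MS.
Proof. by rewrite map_addsmx. Qed.

(** Twisting commutes with sums of row spaces, so the iterated span is generated by the first twists
    of [Y]. *)
Lemma frob_span2_sub (p r N : nat) (Y : 'M[L]_(p, N)) (Z : 'M[L]_(r, N)) :
  (Y <= Z)%MS -> (Y^s <= Z)%MS -> (Y^s^s <= Z)%MS ->
  (frob_span (frob_span Y) <= Z)%MS.
Proof.
move=> Y0 Y1 Y2; rewrite addsmx_sub; apply/andP; split; first by rewrite addsmx_sub Y0.
by apply: submx_trans (frob_span_map_sub Y) _; rewrite addsmx_sub Y1.
Qed.

Lemma frob_span3_sub (p r N : nat) (Y : 'M[L]_(p, N)) (Z : 'M[L]_(r, N)) :
  (Y <= Z)%MS -> (Y^s <= Z)%MS -> (Y^s^s <= Z)%MS -> (Y^s^s^s <= Z)%MS ->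
  (frob_span (frob_span (frob_span Y)) <= Z)%MS.
Proof.
move=> Y0 Y1 Y2 Y3; rewrite addsmx_sub frob_span2_sub //=.
apply: submx_trans (frob_span_map_sub _) _.
by apply: submx_trans (frob_spanS (frob_span_map_sub Y)) _; apply: frob_span2_sub.
Qed.

(** * Consequences of confinement to a row space of rank at most 3 *)

Section TwistedRows.

Variables (r m N : nat) (X : 'M[L]_(m, N)) (Z : 'M[L]_(r, N)) (A : {ffun 'I_m -> L}).
Hypotheses (A_neq0 : forall i, A i != 0) (N_ge5 : (5 <= N)%N).
Hypotheses (ndX : rationally_nondegenerate X) (rZ : (\rank Z <= 3)%N).
Hypotheses (XZ : (X <= Z)%MS) (XsZ : (X^s <= Z)%MS).
Hypothesis twisted :
  forall i, ((row i X^s^s + A (ordS i) *: row (ordS i) X^s^s^s)%R <= Z)%MS.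

(* If [X] had rank at least 2, then [Z] would be [frob_span X], so the third
   Frobenius twist of [X] would lie in [frob_span (frob_span X)]; the latter
   would be stable, hence of rank at least 5, against submodularity. *)
Lemma twisted_rank_le1 : (\rank X <= 1)%N.
Proof.
rewrite leqNgt; apply/negP=> rX.
have S1Z : (frob_span X <= Z)%MS by rewrite addsmx_sub XZ.
have rS1 : (3 <= \rank (frob_span X))%N.
  by apply: leq_trans (frob_span_rank ndX); rewrite leq_min (leq_trans _ N_ge5).
have rS1Z : \rank (frob_span X) = \rank Z.
  by apply/eqP; rewrite eqn_leq mxrankS // (leq_trans rZ).
have ZS1 : (Z <= frob_span X)%MS.
  by have [_ <-] := mxrank_leqif_sup S1Z; rewrite rS1Z.
set S2 := frob_span (frob_span X).
have ZS2 : (Z <= S2)%MS by apply: submx_trans ZS1 (addsmxSl _ _).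
have Xs2 : (X^s^s <= S2)%MS.
  by apply: submx_trans (addsmxSr _ _); rewrite map_submx addsmxSr.
have Xs3 : (X^s^s^s <= S2)%MS.
  apply/row_subP=> i; rewrite -[i]ord_predK; set j := ord_pred i.
  (* Up to a nonzero scalar, the third twist of a row is a vector of [Z] minus the second twist of
     the preceding row. *)
  rewrite -(eqmx_scale _ (A_neq0 (ordS j))) -[X in (X <= _)%MS](addKr (row j X^s^s)).
  apply: addmx_sub _ (submx_trans (twisted j) ZS2).
  by rewrite eqmx_opp; apply: submx_trans (row_sub _ _) Xs2.
(* [S2] is generated by the twists of [X] of order 0 to 2, so its own twist is generated by those of
   order 1 to 3, all of which lie in [S2]. *)
have fullS2 : row_full S2.
  apply: frob_stable_row_full.
    exact/frob_span_nondegenerate/frob_span_nondegenerate.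
  apply: submx_trans (frob_span_map_sub _) _.
  apply: submx_trans (frob_spanS (frob_span_map_sub X)) _.
  by apply: frob_span2_sub => //; apply: submx_trans XsZ ZS2.
(* Submodularity gives [N + \rank X <= 2 * \rank Z <= 6], against [5 + 2 <= N + \rank X]. *)
have := frob_span2_rank X; rewrite -/S2 (eqP fullS2) => le6.
have := leq_trans (leq_add N_ge5 rX) le6.
rewrite rS1Z => le7; have := leq_trans le7 (_ : _ <= 3.*2)%N.
by rewrite leq_double => /(_ rZ).
Qed.

Lemma rank1_twisted :
  exists b (mu : 'I_m -> L), (exists i, mu i != 0) /\
    forall i, A (ordS i) * mu (ordS i) ^+ #|F| = b * mu i.
Proof.
have X_neq0 : X != 0.
  apply/eqP=> X0; have i : 'I_N by exists 0%N; apply: leq_trans N_ge5.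
  have := ndX (c := delta_mx i 0); rewrite X0 mul0mx => /(_ erefl)/matrixP/(_ i 0).
  by rewrite !mxE !eqxx => /eqP; rewrite oner_eq0.
have [i0 v_neq0] : exists i, row i X != 0.
  apply/existsP; apply: contraNT X_neq0 => /existsPn rX0.
  by apply/eqP/row_matrixP=> i; rewrite row0; have /negPn/eqP := rX0 i.
set v := row i0 X in v_neq0.
have rv : \rank v = 1%N by rewrite rank_rV v_neq0.
have vX : (v <= X)%MS by exact: row_sub.
have Xv : (X <= v)%MS.
  have [le1 <-] := mxrank_leqif_sup vX.
  by rewrite eqn_leq le1 rv twisted_rank_le1.
have ndv : rationally_nondegenerate v := rationally_nondegenerateS Xv ndX.
have coef i : exists a, row i X == a *: v.
  by have /sub_rVP[a ->] := submx_trans (row_sub i X) Xv; exists a.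
pose u i := xchoose (coef i).
have Xu i : row i X = u i *: v by exact: eqP (xchooseP (coef i)).
(* [p i] and [t i] are the coefficients of the twisted row [i] on [v^s^s] and [v^s^s^s]. *)
pose p i := frob (frob (u i)); pose t i := A (ordS i) * frob (p (ordS i)).
have pt i : ((p i *: v^s^s + t i *: v^s^s^s)%R <= Z)%MS.
  have := twisted i.
  by rewrite -!map_row !Xu !map_mxZ /= scalerA.
(* If this determinant were nonzero, Cramer's rule would put [v^s^s] and [v^s^s^s] in [Z], next to
   [v] and [v^s], and force rank at least 4. *)
have prop i j : p i * t j = p j * t i.
  apply/eqP; rewrite -subr_eq0; apply: contraLR rZ => det_neq0; rewrite -ltnNge.
  have : (frob_span (frob_span (frob_span v)) <= Z)%MS.
    apply: frob_span3_sub.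
    - exact: submx_trans vX XZ.
    - by apply: submx_trans XsZ; rewrite map_submx.
    - rewrite -(eqmx_scale _ det_neq0).
      have -> : (p i * t j - p j * t i) *: v^s^s =
          t j *: (p i *: v^s^s + t i *: v^s^s^s) - t i *: (p j *: v^s^s + t j *: v^s^s^s).
        by rewrite !scalerDr !scalerA opprD addrACA [t j * t i]mulrC subrr addr0
                   -scalerBl [t j * _]mulrC [t i * _]mulrC.
      by rewrite addmx_sub ?eqmx_opp ?scalemx_sub.
    - rewrite -(eqmx_scale _ det_neq0).
      have -> : (p i * t j - p j * t i) *: v^s^s^s =
          p i *: (p j *: v^s^s + t j *: v^s^s^s) - p j *: (p i *: v^s^s + t i *: v^s^s^s).
        by rewrite !scalerDr !scalerA opprD addrACA [p j * p i]mulrC subrr add0r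
                   -scalerBl.
      by rewrite addmx_sub ?eqmx_opp ?scalemx_sub.
  move/mxrankS; apply: leq_trans; apply: rank_frob_span3; rewrite ?rv //.
  exact: ltnW.
have ui0 : u i0 = 1.
  apply/eqP; rewrite -subr_eq0; apply: contraNT v_neq0 => u1.
  have : (u i0 - 1) *: v == 0 by rewrite scalerBl -Xu scale1r subrr.
  by rewrite scaler_eq0 (negPf u1).
(* As [v] is row [i0] itself, [p i0 = 1], so proportionality with index [i0] makes [t i0] the common
   factor. *)
exists (t i0), p; split; last first.
  move=> i; rewrite -[LHS]mul1r -/(t i); have := prop i0 i.
  by rewrite /p ui0 !rmorph1 [RHS]mulrC.
by exists i0; rewrite /p ui0 !rmorph1 oner_neq0.
Qed.

End TwistedRows.

End FrobeniusMatrix.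

(** * Multiplying the relations around the cycle *)

Lemma KA_is_power (F : finFieldType) (L : fieldExtType F) (m : nat) (A : {ffun 'I_m -> L})
    (b : L) (mu : 'I_m -> L) :
  (forall i, A i != 0) -> (exists i, mu i != 0) ->
  (forall i, A (ordS i) * mu (ordS i) ^+ #|F| = b * mu i) ->
  exists c : L, KA A = c ^+ (\sum_(j < m) #|F| ^ j)%N.
Proof.
move=> A_neq0 [i0 mui0] rec; have q_gt0 : (0 < #|F|)%N by apply/card_gt0P; exists 0.
have b_neq0 : b != 0.
  apply: contraNneq mui0 => b0; have := rec (ord_pred i0).
  rewrite ord_predK b0 mul0r => /eqP; rewrite mulf_eq0 (negPf (A_neq0 _)) /=.
  by rewrite expf_eq0 => /andP[].
have step i : mu i != 0 -> mu (ordS i) != 0.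
  apply: contraNneq => mu0; have /esym/eqP := rec i.
  by rewrite mu0 expr0n eqn0Ngt q_gt0 mulr0 mulf_eq0 (negPf b_neq0).
(* Nonvanishing propagates from [i0] around the cycle; [i] is reached after [i + m - i0] steps. *)
have mu_neq0 i : mu i != 0.
  have mu_iter k : mu (iter k (@ordS m) i0) != 0 by elim: k => //= k /step.
  have iterE k : iter k (@ordS m) i0 = ((i0 + k) %% m)%N :> nat.
    elim: k => [|k IHk]; first by rewrite addn0 modn_small.
    by rewrite /= IHk addnS -[in LHS]addn1 modnDml addn1.
  have -> : i = iter (i + m - i0) (@ordS m) i0; last exact: mu_iter.
  apply/val_inj; rewrite /= iterE subnKC ?modnDr ?modn_small //.
  by apply: leq_trans (ltnW (ltn_ord i0)) (leq_addl _ _).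
case: m A mu A_neq0 i0 rec {mui0 step} mu_neq0 => [|m] A mu A_neq0 i0 rec mu_neq0.
  by case: i0.
set S := (\sum_(j < m.+1) _)%N; set q := #|F|.
have KAS : KA A = \prod_(i < m.+1) A (ordS i) ^+ (q ^ i).
  rewrite /KA (reindex_inj (@ordS_inj _)); apply: eq_bigr => i _.
  by rewrite ordSK.
(* [P] collects the factors common to both sides of the multiplied relations; there remain [mu 0] on
   the right and, after wrapping around, its [q ^ m.+1]-th power on the left. *)
pose P := \prod_(i < m) mu (lift ord0 i) ^+ (q ^ i.+1).
have P_neq0 : P != 0 by apply/prodf_neq0 => i _; rewrite expf_neq0.
have muP : \prod_(i < m.+1) mu i ^+ (q ^ i) = mu 0 * P.
  by rewrite big_ord_recl expn0 expr1.
have musP : \prod_(i < m.+1) (mu (ordS i) ^+ q) ^+ (q ^ i) = P * mu 0 ^+ (q ^ m.+1).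
  rewrite big_ord_recr /= -exprM -expnS; congr (_ * mu _ ^+ _).
    apply: eq_bigr => i _; rewrite -exprM -expnS; congr (mu _ ^+ _).
    by apply/val_inj; rewrite /= modn_small // ltnS ltn_ord.
  by apply/val_inj; rewrite /= modnn.
have KAmu : KA A * mu 0 ^+ (q ^ m.+1) = b ^+ S * mu 0.
  apply: (mulIf P_neq0); rewrite -mulrA [_ * P]mulrC -musP -[RHS]mulrA -muP KAS.
  rewrite -prodrXr -!big_split; apply: eq_bigr => i _.
  by rewrite /= -!exprMn rec.
(* Since [q ^ m.+1 - 1 = (q - 1) * S], the denominator absorbs the leftover power of [mu 0]. *)
exists (b / mu 0 ^+ q.-1); rewrite expr_div_n -exprM -predn_exp.
apply: (mulIf (expf_neq0 (q ^ m.+1) (mu_neq0 0))); rewrite KAmu -mulrA; congr (_ * _).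
rewrite -[in RHS](prednK (n := (q ^ m.+1)%N)) ?expn_gt0 ?q_gt0 // exprS mulrCA mulVf ?mulr1 //.
by rewrite expf_neq0.
Qed.

(** * From an intersection with [H] to the matrices [X] and [Z] *)

Lemma VA2_mapE (F : finFieldType) (L : fieldExtType F) (m : nat) (A x : {ffun 'I_m -> L})
    (i : 'I_m) :
  [/\ VA2_map A x (lshift m (lshift m i)) = x i,
      VA2_map A x (lshift m (rshift m i)) = frob (x i)
    & VA2_map A x (rshift (m + m) i) = fA2 A i x].
Proof.
by split; rewrite ffunE ?(unsplitK (inl _)) ?(unsplitK (inr _)) ?(unsplitK (inl _)).
Qed.

Theorem theorem3p4 (F : finFieldType) (L : fieldExtType F) (q n m : nat)
    (hq : #|F| = q) (hn : \dim {:L} = n) (hm3 : (3 <= m)%N) (hn4 : (4 <= n)%N)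
    (A : {ffun 'I_m -> L}) (hA : forall i : 'I_m, A i != 0)
    (hK : ~ exists b : L, KA A = b ^+ (\sum_(j < m) q ^ j)%N) :
  evasive 3 4 (VA2 A).
Proof.
move=> H dimH; rewrite leqNgt; apply/negP=> N_ge5.
set U := (_ :&: _)%VS in N_ge5; set N := \dim U in N_ge5.
pose e := vbasis U.
have eU (j : 'I_N) : e`_j \in U by apply: vbasis_mem; rewrite mem_nth // size_tuple.
have eV (j : 'I_N) : exists x : {ffun 'I_m -> L}, e`_j = VA2_map A x.
  by apply/memv_VA2; have := eU j; rewrite memv_cap => /andP[].
have eH (j : 'I_N) : (e`_j : {ffun 'I_(m + m + m) -> L^o}) \in H.
  by rewrite -memv_restrict_scalars; have := eU j; rewrite memv_cap => /andP[].
pose X : 'M[L]_(m, N) := \matrix_(i, j) e`_j (lshift m (lshift m i)).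
pose Z : 'M[L]_(\dim H, N) :=
  \matrix_(l, j) coord (vbasis H) l (e`_j : {ffun 'I_(m + m + m) -> L^o}).
(* Coordinate [k] is an L-linear form on [H], so its values on [e] are a combination of the [\dim H]
   rows of [Z]. *)
have rowZ (k : 'I_(m + m + m)) : (\row_j e`_j k <= Z)%MS.
  suff -> : \row_j e`_j k =
      (\row_l ((vbasis H)`_l : {ffun 'I_(m + m + m) -> L^o}) k : 'rV[L]_(\dim H)) *m Z.
    exact: submxMl.
  apply/rowP=> j; rewrite !mxE {1}(coord_vbasis (eH j)) sum_ffunE.
  by apply: eq_bigr => l _; rewrite !mxE ffunE mulrC.
have VX (j : 'I_N) : e`_j = VA2_map A [ffun i => X i j].
  have [x ex] := eV j; rewrite ex; congr (VA2_map A _).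
  by apply/ffunP=> i; rewrite ffunE mxE ex; have [-> _ _] := VA2_mapE A x i.
case: hK; rewrite -hq.
have [||||i|b [mu [mu_neq0 rec]]] := @rank1_twisted _ _ _ _ _ X Z A hA N_ge5.
(* The F-linear [VA2_map] carries an F-relation between the columns of [X] to one between the basis
   vectors of [U]. *)
- move=> c Xc.
  have c0 : \sum_(j < N) c j 0 *: e`_j = 0.
    rewrite (eq_bigr _ (fun j _ => congr1 _ (VX j))).
    rewrite -(eq_bigr _ (fun j _ => linearZ _ _)) -linear_sum.
    rewrite (_ : \sum_j _ = 0) ?linear0 //; apply/ffunP=> i.
    rewrite sum_ffunE [RHS]ffunE; move/matrixP: Xc => /(_ i 0); rewrite !mxE => Xc.
    by rewrite -[RHS]Xc; apply: eq_bigr => j _; rewrite !ffunE !mxE mulr_algr.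
  apply/matrixP=> j k; rewrite ord1 [RHS]mxE.
  by have /freeP/(_ (fun j => c j 0) c0 j) := basis_free (vbasisP U).
- by rewrite -dimH rank_leq_row.
(* The three blocks of coordinates supply in turn the rows of [X], those of its twist and the
   twisted combinations. *)
- apply/row_subP=> i; apply: submx_trans (rowZ (lshift m (lshift m i))).
  rewrite (_ : row i X = \row_j e`_j (lshift m (lshift m i))) //.
  by apply/rowP=> j; rewrite !mxE.
- apply/row_subP=> i; apply: submx_trans (rowZ (lshift m (rshift m i))).
  rewrite (_ : row i _ = \row_j e`_j (lshift m (rshift m i))) //.
  apply/rowP=> j; rewrite [RHS]mxE VX.
  by have [_ -> _] := VA2_mapE A [ffun i => X i j] i; rewrite ffunE !mxE.
- apply: submx_trans (rowZ (rshift (m + m) i)).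
  rewrite (_ : (_ + _)%R = \row_j e`_j (rshift (m + m) i)) //.
  apply/rowP=> j; rewrite [RHS]mxE VX.
  have [_ _ ->] := VA2_mapE A [ffun i => X i j] i.
  by rewrite /fA2 -!iter_frob !ffunE !mxE.
exact: KA_is_power hA mu_neq0 rec.
Qed.
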